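(* Let $G$ be a finite abelian group and $A$ a finite set of size $q \geq 2$. Let $H_1, H_2, \dots, H_r$ be the list of different subgroups of $G$ with $H_1 = G$. For each $1 \leq i \leq r$, let $\alpha_i := \alpha_{[H_i]}(G;A)$. Then \[ \mathrm{Rank}(\mathrm{CA}(G;A) : \mathrm{ICA}(G;A)) = |\mathcal{E}_G| - \sum_{i=2}^r \delta(\alpha_i, 1), \] where $\delta : \mathbb{N}^2 \to \{0,1\}$ is Kronecker's delta function.
   Context: Functions are applied on the right and composed left to right. $A^G$ is the set of all functions $x : G \to A$. A cellular automaton over $G$ and $A$ is a map $\tau : A^G \to A^G$ for which there are a finite subset $S \subseteq G$ (a memory set) and a local function $\mu : A^S \to A$ with $(g)(x)\tau = ((R_g \circ x)|_S)\mu$ for all $x \in A^G$, $g \in G$, where $(h)R_g := hg$, so that $(h)(R_g\circ x) = (hg)x$. $\mathrm{CA}(G;A)$ is the monoid of all cellular automata over $G$ and $A$ under composition, and $\mathrm{ICA}(G;A)$ is its group of invertible elements (those $\tau\in\mathrm{CA}(G;A)$ with a two-sided inverse in $\mathrm{CA}(G;A)$). $G$ acts on $A^G$ by $(h)(x \cdot g) = (hg^{-1})x$ for $h\in G$. The $G$-orbit of $x$ is $xG := \{x \cdot g : g \in G\}$; the stabiliser is $G_x := \{g \in G : x \cdot g = x\}$. $[H]$ is the conjugacy class of a subgroup $H \leq G$ (equal to $\{H\}$ when $G$ is abelian), $B_{[H]} := \{x \in A^G : G_x \in [H]\}$ (a union of $G$-orbits), and $\alpha_{[H]}(G;A)$ is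 the number of $G$-orbits contained in $B_{[H]}$. $\mathcal{C}_G$ is the set of conjugacy classes of subgroups of $G$; $[H] \leq [K]$ means $H \leq g^{-1}Kg$ for some $g \in G$. $\mathcal{E}_G := \{([H],[K]) \in \mathcal{C}_G^2 : [H] \leq [K]\}$, which includes the loops $([H],[H])$. When $G$ is abelian, $\mathcal{E}_G$ is identified with the set of pairs $(H,K)$ of subgroups of $G$ with $H \leq K$. For a finite monoid $M$ and $U \subseteq M$, the relative rank $\mathrm{Rank}(M:U)$ is the minimum cardinality of a subset $V \subseteq M$ such that the submonoid generated by $U \cup V$ is $M$. *)

(* Defs.v *)
From HB Require Import structures.
From mathcomp Require Import all_boot all_fingroup.

Set Implicit Arguments.
Unset Strict Implicit.
Unset Printing Implicit Defensive.

Import GroupScope.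

(* Finite monoids are given as a finType with a [Monoid.law]. *)
Section FiniteMonoid.
Variables (M : finType) (e : M) (op : Monoid.law e).
Implicit Types U V W : {set M}.

Definition invertibles : {set M} :=
  [set x | [exists y, (op x y == e) && (op y x == e)]].

Definition is_submonoid W : bool :=
  (e \in W) && [forall x in W, forall y in W, op x y \in W].

Definition submonoid_gen U : {set M} :=
  \bigcap_(W : {set M} | is_submonoid W && (U \subset W)) W.

(* The minimum ranges over a nonempty family, since V = M always generates M. *)
Definition relative_rank U : nat :=
  #|[arg min_(V < [set: M] | submonoid_gen (U :|: V) == [set: M]) #|V| ]|.

End FiniteMonoid.

Section Configurations.
Variables (gT : finGroupType) (A : finType).

Definition config := {ffun gT -> A}.

Implicit Types (x : config) (g h : gT).

Definition shift x g : config := [ffun h => x (h * g^-1)].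

Lemma shift1 x : shift x 1 = x.
Proof. by apply/ffunP=> h; rewrite ffunE invg1 mulg1. Qed.

Lemma shiftM x g h : shift x (g * h) = shift (shift x g) h.
Proof. by apply/ffunP=> k; rewrite !ffunE invMg mulgA. Qed.

Definition shift_action := TotalAction shift1 shiftM.

Definition conj_class (H : {set gT}) : {set {set gT}} := H :^: [set: gT].

Definition stab_box (H : {set gT}) : {set config} :=
  [set x : config | 'C[x | shift_action] \in conj_class H].

Definition orbit_count (H : {set gT}) : nat :=
  #|[set O in [set orbit shift_action [set: gT] x | x in [set: config]]
       | O \subset stab_box H]|.

(* tau is encoded as a finite function, and (g)(x)tau is written t x g. The
   local function mu has domain A^S, where S is seen as the subtype of gT. *)
Definition is_cellular_automaton (t : {ffun config -> config}) : bool :=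
  [exists S : {set gT},
    exists mu : {ffun {ffun {h : gT | h \in S} -> A} -> A},
    forall x : config, forall g : gT,
      t x g == mu [ffun h : {h : gT | h \in S} => x (val h * g)]].

(* Since gT is finite, cellular automata are the shift-equivariant maps. *)
Lemma is_cellular_automatonP (t : {ffun config -> config}) :
  reflect (forall x g, t (shift x g) = shift (t x) g)
          (is_cellular_automaton t).
Proof.
apply: (iffP existsP) => [[S /existsP [mu /forallP tE]] x g | tE].
  apply/ffunP=> h; rewrite ffunE.
  move/forallP: (tE (shift x g)) => /(_ h)/eqP->.
  move/forallP: (tE x) => /(_ (h * g^-1))/eqP->.
  by congr (mu _); apply/ffunP=> k; rewrite !ffunE mulgA.
exists [set: gT]; apply/existsP.
exists [ffun y : {ffun {h : gT | h \in [set: gT]} -> A} =>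
          t [ffun h => y (exist _ h (in_setT h))] 1].
apply/forallP=> x; apply/forallP=> g; rewrite ffunE; apply/eqP.
have -> : [ffun h => [ffun k : {h : gT | h \in [set: gT]} => x (val k * g)]
                       (exist _ h (in_setT h))] = shift x g^-1.
  by apply/ffunP=> h; rewrite !ffunE /= invgK.
by rewrite tE ffunE invgK mul1g.
Qed.

Record CA := CellularAutomaton {
  ca_fun :> {ffun config -> config};
  _ : is_cellular_automaton ca_fun
}.

HB.instance Definition _ := [isSub for ca_fun].
HB.instance Definition _ := [Finite of CA by <:].

Lemma ca_id_subproof : is_cellular_automaton [ffun x : config => x].
Proof. by apply/is_cellular_automatonP=> x g; rewrite !ffunE. Qed.

Definition ca_id : CA := CellularAutomaton ca_id_subproof.

Lemma ca_comp_subproof (t s : CA) :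
  is_cellular_automaton [ffun x : config => s (t x)].
Proof.
apply/is_cellular_automatonP=> x g; rewrite !ffunE.
rewrite (is_cellular_automatonP _ (valP t)).
by rewrite (is_cellular_automatonP _ (valP s)).
Qed.

(* Composed left to right: first t, then s. *)
Definition ca_comp (t s : CA) : CA := CellularAutomaton (ca_comp_subproof t s).

Lemma ca_compA : associative ca_comp.
Proof. by move=> t s r; apply/val_inj/ffunP=> x; rewrite /= !ffunE. Qed.

Lemma ca_comp1l : left_id ca_id ca_comp.
Proof. by move=> t; apply/val_inj/ffunP=> x; rewrite /= !ffunE. Qed.

Lemma ca_comp1r : right_id ca_id ca_comp.
Proof. by move=> t; apply/val_inj/ffunP=> x; rewrite /= !ffunE. Qed.

HB.instance Definition _ :=
  Monoid.isLaw.Build CA ca_id ca_comp ca_compA ca_comp1l ca_comp1r.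

Definition ICA : {set CA} := invertibles ca_comp.

End Configurations.

Section SubgroupClasses.
Variable gT : finGroupType.

Definition subgroup_classes : {set {set {set gT}}} :=
  [set conj_class H | H : {group gT}].

(* [H] <= [K] does not depend on the representatives H and K, since H is only
   required to be contained in some conjugate K :^ g = g^-1 K g. *)
Definition class_le (c d : {set {set gT}}) : bool :=
  [exists H : {group gT}, exists K : {group gT},
    [&& c == conj_class H, d == conj_class K
      & [exists g : gT, H \subset K :^ g]]].

Definition subgroup_edges : {set {set {set gT}} * {set {set gT}}} :=
  [set p | [&& p.1 \in subgroup_classes, p.2 \in subgroup_classes
             & class_le p.1 p.2]].

End SubgroupClasses.

(* Main.v *)
(* A non-bijective cellular automaton t "of type (H, K)" is injective away from
   one orbit xG with G_x = H, and moves x to a configuration with stabiliser K.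
   When a product is of type (H, K), so is one of its factors, and no map has
   two types; hence a generating set modulo the units needs one map of each type
   that occurs, which excludes only the loops (H, H) with a single orbit.

   Conversely, let e_{x,y} send xg to yg and fix the other configurations. The
   units act by conjugation transitively on the e_{x,y} with given stabilisers
   G_x <= G_y and distinct orbits, so one of each type suffices to obtain all of
   them. If t is not bijective, choose z outside its image with G_z as small as
   possible: then some x with G_x = G_z can be redirected to z so that the image
   grows and t is the redirected map followed by e_{z, (x)t}. *)
Require Import Defs.
From mathcomp Require Import all_boot all_fingroup.

Set Implicit Arguments.
Unset Strict Implicit.
Unset Printing Implicit Defensive.

Import GroupScope.

(** * Generated submonoids and relative rank *)

Section RelativeRank.
Variables (M : finType) (e : M) (op : Monoid.law e).
Implicit Types U V W : {set M}.

Lemma submonoid_gen_min U W :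
  is_submonoid op W -> U \subset W -> submonoid_gen op U \subset W.
Proof. by move=> sW sUW; apply: bigcap_inf; rewrite sW. Qed.

Lemma sub_submonoid_gen U : U \subset submonoid_gen op U.
Proof. by apply/bigcapsP=> W /andP[]. Qed.

Lemma submonoid_genM U x y :
  x \in submonoid_gen op U -> y \in submonoid_gen op U ->
  op x y \in submonoid_gen op U.
Proof.
move=> /bigcapP xU /bigcapP yU; apply/bigcapP=> W sW.
case/andP: (sW) => /andP[_ /forall_inP/(_ x (xU W sW))/forall_inP] + _.
by apply; apply: yU.
Qed.

Lemma relative_rank_eq U n :
    (forall V, submonoid_gen op (U :|: V) = [set: M] -> n <= #|V|) ->
    (exists2 V, submonoid_gen op (U :|: V) = [set: M] & #|V| <= n) ->
  relative_rank op U = n.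
Proof.
move=> lb [V genV leV]; rewrite /relative_rank; case: arg_minnP => [|W].
  by rewrite setUT -subTset sub_submonoid_gen.
move=> /eqP/lb leW /(_ V); rewrite genV eqxx => /(_ isT) leWV.
by apply/eqP; rewrite eqn_leq leW (leq_trans leWV leV).
Qed.

End RelativeRank.

(** * Equivariance, orbits, stabilisers and redirection of an orbit *)

Section CellularAutomata.
Variables (gT : finGroupType) (A : finType).
Local Notation conf := (config gT A).
Local Notation ca := (CA gT A).
Local Notation idc := (ca_id gT A).
Local Notation stab x := 'C[x | shift_action gT A].
Local Notation orb x := (orbit (shift_action gT A) [set: gT] x).
Implicit Types (x y z w : conf) (g : gT) (s t u : ca)
  (p q : {group gT} * {group gT}).

Lemma ca_shift t x g : t (shift x g) = shift (t x) g.
Proof. exact: (is_cellular_automatonP _ (valP t)). Qed.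

Lemma ca_compE t s x : ca_comp t s x = s (t x).
Proof. by rewrite /= ffunE. Qed.

Lemma ca_idE x : idc x = x.
Proof. by rewrite /= ffunE. Qed.

Lemma ca_ext t s : (forall x, t x = s x) -> t = s.
Proof. by move=> eq_ts; apply/val_inj/ffunP. Qed.

Lemma stabP x g : reflect (shift x g = x) (g \in stab x).
Proof. by rewrite !inE sub1set inE; apply: eqP. Qed.

Lemma orbP x y : reflect (exists g, y = shift x g) (y \in orb x).
Proof.
apply: (iffP orbitP) => [[g _ <-] | [g ->]]; first by exists g.
by exists g; rewrite ?inE.
Qed.

Lemma orb_refl x : x \in orb x.
Proof. exact: orbit_refl. Qed.

Lemma orb_sym x y : (y \in orb x) = (x \in orb y).
Proof. exact: orbit_sym. Qed.

Lemma mem_orb_shift x y g : (shift y g \in orb x) = (y \in orb x).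
Proof.
apply/orbP/orbP=> [[h yE] | [h ->]]; last by exists (h * g); rewrite shiftM.
by exists (h * g^-1); rewrite shiftM -yE -shiftM mulgV shift1.
Qed.

Lemma shiftV x y g : shift x g = y -> x = shift y g^-1.
Proof. by move=> <-; rewrite -shiftM mulgV shift1. Qed.

Lemma shift_eqP x g h :
  reflect (shift x g = shift x h) (g * h^-1 \in stab x).
Proof.
apply: (iffP (stabP _ _)) => [xgh | xgh].
  by rewrite -[in RHS]xgh -shiftM mulgKV.
by rewrite shiftM xgh -shiftM mulgV shift1.
Qed.

Lemma stab_ca t x : stab x \subset stab (t x).
Proof. by apply/subsetP=> g /stabP xg; apply/stabP; rewrite -ca_shift xg. Qed.

(** Injectivity is asked on one orbit only, so that the lemma also serves maps that are injective
    merely off another orbit. *)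
Lemma stab_inj_in t x :
  {in orb x &, injective t} -> stab (t x) = stab x.
Proof.
move=> inj_t; apply/eqP; rewrite eqEsubset stab_ca andbT.
apply/subsetP=> g /stabP; rewrite -ca_shift => /inj_t tE; apply/stabP/tE.
  by rewrite mem_orb_shift orb_refl.
exact: orb_refl.
Qed.

(* Sends [shift x g] to [shift w g] and agrees with t off the orbit of x; as a
   cellular automaton it falls back to t unless G_x is contained in G_w. *)
Definition redirect_fun t x w : {ffun conf -> conf} :=
  [ffun z => if [pick g | shift x g == z] is Some g then shift w g else t z].

Definition redirect t x w : ca := insubd t (redirect_fun t x w).

Lemma redirect_fun_in t x w g :
  stab x \subset stab w -> redirect_fun t x w (shift x g) = shift w g.
Proof.
move=> /subsetP sxw; rewrite ffunE; case: pickP => [h /eqP | /(_ g)].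
  by move/shift_eqP/sxw/shift_eqP.
by rewrite eqxx.
Qed.

Lemma redirect_fun_out t x w z : z \notin orb x -> redirect_fun t x w z = t z.
Proof.
move=> zx; rewrite ffunE; case: pickP => // g /eqP gz.
by case/orbP: zx; exists g.
Qed.

Lemma redirect_caP t x w :
  stab x \subset stab w -> is_cellular_automaton (redirect_fun t x w).
Proof.
move=> sxw; apply/is_cellular_automatonP=> z g.
case: (boolP (z \in orb x)) => [/orbP[h ->] | zx].
  by rewrite -shiftM !redirect_fun_in // shiftM.
by rewrite !redirect_fun_out ?mem_orb_shift // ca_shift.
Qed.

Lemma redirect_in t x w g :
  stab x \subset stab w -> redirect t x w (shift x g) = shift w g.
Proof.
by move=> sxw; rewrite [ca_fun _]insubdK ?redirect_fun_in //; apply: redirect_caP.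
Qed.

Lemma redirect_id t x w : stab x \subset stab w -> redirect t x w x = w.
Proof. by move/(redirect_in t 1); rewrite !shift1. Qed.

Lemma redirect_out t x w z :
  stab x \subset stab w -> z \notin orb x -> redirect t x w z = t z.
Proof.
move=> sxw zx.
by rewrite [ca_fun _]insubdK ?redirect_fun_out //; apply: redirect_caP.
Qed.

(** * Units and swaps of orbits *)

Lemma ca_surj_inj t : (forall z, exists y, t y = z) -> injective t.
Proof.
move=> surj_t; apply/injectiveP/dinjectiveP/image_injP/eqP.
by apply: eq_card => z; rewrite inE; apply/codomP; have [y <-] := surj_t z; exists y.
Qed.

Lemma ICA_inj t : t \in ICA gT A -> injective t.
Proof.
rewrite inE => /existsP[s /andP[/eqP ts _]] x y txy.
by rewrite -(ca_idE x) -(ca_idE y) -ts !ca_compE txy.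
Qed.

Lemma inj_ICA t :
  injective t -> exists2 s, s \in ICA gT A & cancel t s /\ cancel s t.
Proof.
move=> inj_t; have sP : is_cellular_automaton [ffun x => invF inj_t x].
  apply/is_cellular_automatonP=> x g; rewrite !ffunE.
  by apply: (inj_t); rewrite ca_shift !f_invF.
have tK : cancel t (CellularAutomaton sP) by move=> x; rewrite /= ffunE invF_f.
have Kt : cancel (CellularAutomaton sP) t by move=> x; rewrite /= ffunE f_invF.
exists (CellularAutomaton sP) => //; rewrite inE; apply/existsP; exists t.
by apply/andP; split; apply/eqP/ca_ext => x; rewrite ca_compE ca_idE.
Qed.

Lemma mem_ICA t : (t \in ICA gT A) = injectiveb t.
Proof.
apply/idP/injectiveP; first exact: ICA_inj.
case/inj_ICA=> s _ [tK Kt]; rewrite inE; apply/existsP; exists s.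
by apply/andP; split; apply/eqP/ca_ext => x; rewrite ca_compE ca_idE.
Qed.

(* When x and y lie in one orbit, this is the translation of that orbit taking y
   to x, hence still a unit. *)
Definition swap x y : ca := redirect (redirect idc x y) y x.

Lemma swap_id x y : stab x = stab y -> swap x y y = x.
Proof. by move=> sxy; rewrite redirect_id ?sxy. Qed.

Lemma swap_out x y z : stab x = stab y ->
  z \notin orb x -> z \notin orb y -> swap x y z = z.
Proof. by move=> sxy zx zy; rewrite !redirect_out ?sxy ?ca_idE. Qed.

Lemma swap_inj x y : stab x = stab y -> injective (swap x y).
Proof.
move=> sxy; apply: ca_surj_inj => z.
have [/orbP[g ->] | zx] := boolP (z \in orb x).
  by exists (shift y g); rewrite redirect_in ?sxy.
have [/orbP[g zE] | zy] := boolP (z \in orb y); last first.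
  by exists z; rewrite swap_out.
(* Here the orbits of [x] and [y] differ, so the outer redirection leaves [shift x g] to the inner
   one, which sends it to [shift y g]. *)
exists (shift x g); rewrite redirect_out ?sxy // ?redirect_in ?sxy //.
by rewrite mem_orb_shift orb_sym -(mem_orb_shift x y g) -zE.
Qed.

(** * Collapses and their conjugation by units *)

Definition collapse x y : ca := redirect idc x y.

Lemma collapse_conj x y u : stab x \subset stab y -> injective u ->
  forall z, collapse (u x) (u y) (u z) = u (collapse x y z).
Proof.
move=> sxy inj_u z; have stu w : stab (u w) = stab w.
  by apply: stab_inj_in => ? ? _ _ /inj_u.
have [/orbP[g ->] | zx] := boolP (z \in orb x).
  by rewrite ca_shift !redirect_in ?stu // ca_shift.
rewrite !redirect_out ?stu // ?ca_idE //; apply: contra zx => /orbP[g].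
by rewrite -ca_shift => /inj_u->; rewrite mem_orb_shift orb_refl.
Qed.

(** Two swaps suffice: [a] moves [x] to [x'], then [b] moves [a y] to [y']. The second fixes [x'],
    whose orbit contains neither [a y] nor [y']. *)
Lemma collapse_transport x y x' y' :
    stab x = stab x' -> stab y = stab y' -> y \notin orb x -> y' \notin orb x' ->
  exists2 u : ca, injective u & u x = x' /\ u y = y'.
Proof.
move=> sx sy yx yx'; pose a := swap x' x; pose b := swap y' (a y).
have inj_a : injective a by apply: swap_inj.
have ax : a x = x' by apply: swap_id.
have say : stab y' = stab (a y).
  by rewrite (@stab_inj_in a) // => ? ? _ _ /inj_a.
exists (ca_comp a b) => [z1 z2|].
  by rewrite !ca_compE => /(swap_inj say)/inj_a.
rewrite !ca_compE ax; split; last exact: swap_id.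
apply: swap_out => //.
  by rewrite orb_sym.
rewrite orb_sym; apply: contra yx => /orbP[g]; rewrite -ax -ca_shift => /inj_a->.
by rewrite mem_orb_shift orb_refl.
Qed.

Lemma gen_collapse (W : {set ca}) x y x' y' :
    (forall s t, s \in W -> t \in W -> ca_comp s t \in W) ->
    ICA gT A \subset W -> stab x \subset stab y ->
    stab x = stab x' -> stab y = stab y' -> y \notin orb x -> y' \notin orb x' ->
  collapse x y \in W -> collapse x' y' \in W.
Proof.
move=> mulW /subsetP sIW sxy sx sy yx yx' Wxy.
have [u inj_u [ux uy]] := collapse_transport sx sy yx yx'.
have [d Id [uK Ku]] := inj_ICA inj_u.
(* Conjugation by [u], with inverse [d], in left-to-right order. *)
have -> : collapse x' y' = ca_comp d (ca_comp (collapse x y) u).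
  apply: ca_ext => z; rewrite !ca_compE -[in LHS](Ku z) -ux -uy.
  exact: collapse_conj.
have Wu : u \in W by apply: sIW; rewrite mem_ICA; apply/injectiveP.
by apply: (mulW); [apply: sIW | apply: mulW].
Qed.

(** * Types of non-bijective automata *)

Hypothesis cGG : abelian [set: gT].

Lemma stab_shift x g : stab (shift x g) = stab x.
Proof.
have cg a b : a * b = b * a :> gT by apply: (centsP cGG); rewrite inE.
apply/setP=> h; apply/stabP/stabP=> [|xh]; last by rewrite -shiftM cg shiftM xh.
by rewrite -shiftM cg shiftM => /shiftV; rewrite -shiftM mulgV shift1.
Qed.

Lemma stab_orb x y : y \in orb x -> stab y = stab x.
Proof. by case/orbP=> g ->; apply: stab_shift. Qed.

Definition inj_off t x := {in [predC orb x] &, injective t}.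

Lemma stab_inj_off t x z : inj_off t x -> z \notin orb x -> stab (t z) = stab z.
Proof.
move=> inj_t zx; apply: stab_inj_in => ? ? /orbP[g ->] /orbP[h ->].
by apply: inj_t; rewrite !inE mem_orb_shift.
Qed.

(** If [t] preserves the stabiliser of [x], it is injective on that orbit, so a failure of
    injectivity must involve another orbit. If the stabiliser grows, counting yields the
    collision. *)
Lemma inj_off_collision t x : ~ injective t -> inj_off t x ->
  exists2 z, z \notin orb x & t z = t x.
Proof.
move=> ninj inj_t.
have [/existsP[z /andP[zx /eqP tz]] | /existsPn no_z] :=
  boolP [exists z, (z \notin orb x) && (t z == t x)]; first by exists z.
(* If G_x grows under t, then t permutes the configurations with stabiliser
   G_(t x), none of which lies in the orbit of x. *)
have [sx | nsx] := eqVneq (stab (t x)) (stab x).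
  (* By equivariance, a collision anywhere on the orbit of [x] can be shifted to one at [x]
     itself. *)
  have mixed y z : y \in orb x -> z \notin orb x -> t y <> t z.
    case/orbP=> g -> zx; rewrite ca_shift => /shiftV.
    rewrite -ca_shift => tE; case/negP: (no_z (shift z g^-1)).
    by rewrite mem_orb_shift zx tE eqxx.
  case: ninj => y z tyz.
  have [yx | yx] := boolP (y \in orb x); have [zx | zx] := boolP (z \in orb x).
  - case/orbP: yx zx tyz => [g ->] /orbP[h ->].
    rewrite !ca_shift => /shiftV; rewrite -shiftM => /esym/stabP.
    rewrite sx => /stabP; rewrite shiftM => /shiftV.
    by rewrite invgK.
  - by case: (mixed y z).
  - by case: (mixed z y).
  - exact: inj_t.
pose B := [set z | stab z == stab (t x)].
have Bx z : z \in B -> z \notin orb x.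
  by rewrite inE => /eqP sz; apply: contra nsx => /stab_orb <-; rewrite sz.
have tB : t @: B = B.
  apply/eqP; rewrite eqEcard card_in_imset ?leqnn ?andbT; last first.
    by move=> y z /Bx yx /Bx zx; apply: inj_t; rewrite !inE.
  apply/subsetP=> _ /imsetP[z Bz ->].
  by rewrite inE (stab_inj_off inj_t) ?Bx //; rewrite inE in Bz.
have: t x \in t @: B by rewrite tB inE.
by case/imsetP=> z Bz ->; exists z => //; apply: Bx.
Qed.

(** Boolean, so that the maps not of type [p] form a finite set, to be recognised as a submonoid. *)
Definition collapse_type (p : {group gT} * {group gT}) t :=
  ~~ injectiveb t &&
  [exists x, [&& stab x == p.1, stab (t x) == p.2 &
    [forall y in [predC orb x], forall z in [predC orb x],
       (t y == t z) ==> (y == z)]]].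

Lemma collapse_typeP p t :
  reflect (~ injective t /\
           exists x, [/\ stab x = p.1, stab (t x) = p.2 & inj_off t x])
          (collapse_type p t).
Proof.
apply: (iffP andP) => [[/injectiveP ninj /existsP[x /and3P[/eqP sx /eqP stx]]] |].
  move/forall_inP=> inj_t; split=> //; exists x; split=> // y z yx zx tyz.
  by apply/eqP; move/forall_inP: (inj_t y yx) => /(_ z zx)/implyP; rewrite tyz; apply.
case=> ninj [x [sx stx inj_t]]; split; first exact/injectiveP.
apply/existsP; exists x; rewrite sx stx !eqxx /=.
apply/forall_inP=> y yx; apply/forall_inP=> z zx; apply/implyP=> /eqP tyz.
by apply/eqP/inj_t.
Qed.

(** If witnesses [x] and [x'] lie in different orbits, [x'] collides with some [z] off its orbit,
    and injectivity off the orbit of [x] forces [z] into that orbit. So [t x] and [t x'] share an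
    orbit, and each of [x], [x'], lying off the other's orbit, keeps its stabiliser under [t]. *)
Lemma collapse_type_uniq p q t :
  collapse_type p t -> collapse_type q t -> p = q.
Proof.
case: p q => [p1 p2] [q1 q2].
move=> /collapse_typeP[ninj [x /= [sx stx injx]]].
move=> /collapse_typeP[_ [x' /= [sx' stx' injx']]].
suff [eq1 eq2] : stab x = stab x' /\ stab (t x) = stab (t x').
  by congr (_, _); apply/val_inj; rewrite /= -?sx -?sx' -?stx -?stx'.
have [x'x | x'x] := boolP (x' \in orb x).
  by case/orbP: x'x => g ->; rewrite ca_shift !stab_shift.
have [z zx' tz] := inj_off_collision ninj injx'.
have [/orbP[g zE] | zx] := boolP (z \in orb x); last first.
  have zE : z = x' by apply: injx; rewrite ?inE.
  by rewrite zE orb_refl in zx'.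
have stE : stab (t x) = stab (t x') by rewrite -tz zE ca_shift stab_shift.
split=> //; rewrite -(stab_inj_off injx x'x) -stE (stab_inj_off injx') //.
by rewrite orb_sym.
Qed.

(** An injective [s] is a unit and carries the witness [x] to the witness [s x] for [t]. Otherwise
    [s] itself inherits the type, with the same [x]. *)
Lemma collapse_type_comp p s t :
  collapse_type p (ca_comp s t) -> collapse_type p s || collapse_type p t.
Proof.
case/collapse_typeP=> ninj [x [sx stx inj_st]].
have [inj_s | ninj_s] := boolP (injectiveb s).
  have{} inj_s := injectiveP _ inj_s.
  have [d _ [sK Ks]] := inj_ICA inj_s.
  apply/orP; right; apply/collapse_typeP; split.
    by move=> inj_t; apply: ninj => y z; rewrite !ca_compE => /inj_t/inj_s.
  exists (s x); rewrite -ca_compE; split=> //.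
    by rewrite (@stab_inj_in s) // => ? ? _ _ /inj_s.
  have off y : y \notin orb (s x) -> d y \notin orb x.
    apply: contra => /orbP[g dyE]; rewrite -(Ks y) dyE ca_shift mem_orb_shift.
    exact: orb_refl.
  move=> y z /off yx /off zx tyz; rewrite -(Ks y) -(Ks z); congr (s _).
  by apply: inj_st; rewrite ?inE // !ca_compE !Ks.
apply/orP; left; apply/collapse_typeP.
have{} ninj_s : ~ injective s by apply/injectiveP.
have injs : inj_off s x.
  by move=> y z yx zx syz; apply: inj_st => //; rewrite !ca_compE syz.
split=> //; exists x; split=> //.
(* [z] has the same images as [x] and keeps its stabiliser under both [s] and the product, so [s x]
   already has stabiliser [p.2]. *)
have [z zx sz] := inj_off_collision ninj_s injs.
rewrite -stx ca_compE -sz -ca_compE (stab_inj_off inj_st zx).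
exact: stab_inj_off zx.
Qed.

Lemma collapse_typed (p : {group gT} * {group gT}) x y :
    stab x = p.1 -> stab y = p.2 -> p.1 \subset p.2 -> y \notin orb x ->
  collapse_type p (collapse x y).
Proof.
move=> sx sy; rewrite -sx -sy => sxy yx; apply/collapse_typeP; split.
  have: collapse x y x = collapse x y y.
    by rewrite redirect_id // redirect_out ?ca_idE.
  by move=> + inj_c => /inj_c xE; rewrite -xE orb_refl in yx.
exists x; rewrite redirect_id //; split=> // z w zx wx.
by rewrite !redirect_out ?ca_idE //; rewrite !inE in zx wx.
Qed.

(** * Factoring a non-bijective automaton through collapses *)

Lemma min_stab_missing t z : z \notin codom t ->
    (forall y, y \notin codom t -> #|stab z| <= #|stab y|) ->
  forall y, stab (t y) = stab z -> stab y = stab z.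
Proof.
move=> zt minz y sty.
have [//|nsy] := eqVneq (stab y) (stab z).
have lty : #|stab y| < #|stab z|.
  by apply: proper_card; rewrite properEneq nsy -sty stab_ca.
(* Every configuration with a stabiliser smaller than G_z is in the image, and its
   preimages have small stabilisers too, so t permutes these configurations. *)
pose Y := [set w | #|stab w| < #|stab z|].
have subY : t @^-1: Y \subset Y.
  apply/subsetP=> w; rewrite !inE; apply: leq_trans.
  by rewrite ltnS subset_leq_card ?stab_ca.
have Yt : Y \subset t @: (t @^-1: Y).
  apply/subsetP=> w Yw.
  have /codomP[v vE] : w \in codom t.
    by apply: contraTT Yw => /minz; rewrite inE -leqNgt.
  by apply/imsetP; exists v; rewrite // inE -vE.
have preY : t @^-1: Y = Y.
  apply/eqP; rewrite eqEcard subY.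
  exact: leq_trans (subset_leq_card Yt) (leq_imset_card _ _).
have: y \in Y by rewrite inE.
by rewrite -preY !inE sty ltnn.
Qed.

(** Redirecting [x] to a missed [z] adds the orbit of [z] to the image and can lose only that of
    [t x]. There is a net gain if the lost orbit is smaller, or if it is still reached from another
    orbit. *)
Lemma factor_collapse t : ~ injective t ->
  exists x z, [/\ stab x = stab z, z \notin orb (t x),
    t = ca_comp (redirect t x z) (collapse z (t x)) &
    #|codom t| < #|codom (redirect t x z)| ].
Proof.
move=> ninj; have [z0 z0t] : exists z, z \notin codom t.
  apply/existsP; apply: contra_notT ninj => /existsPn surj_t.
  by apply: ca_surj_inj => z; have /negPn/codomP[y ->] := surj_t z; exists y.
have [z zt minz] := @arg_minnP _ z0 (fun y => y \notin codom t)
  (fun y => #|stab y|) z0t.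
have pre_z := min_stab_missing zt minz.
have zorb y : z \notin orb (t y).
  by apply: contra zt => /orbP[g ->]; rewrite -ca_shift codom_f.
have factor x : stab x = stab z ->
    t = ca_comp (redirect t x z) (collapse z (t x)).
  move=> sx; apply: ca_ext => y; rewrite ca_compE.
  have stx : stab z \subset stab (t x) by rewrite -sx stab_ca.
  have [/orbP[g ->] | yx] := boolP (y \in orb x).
    by rewrite ca_shift redirect_in ?sx // redirect_in.
  by rewrite [redirect _ _ _ y]redirect_out ?sx // redirect_out ?ca_idE // orb_sym.
pose im s : {set conf} := [set y in codom s].
have orbz x : stab x = stab z -> orb z \subset im (redirect t x z).
  move=> sx; apply/subsetP=> _ /orbP[g ->]; rewrite inE.
  by rewrite -(redirect_in t g (x := x)) ?sx // codom_f.
have im_t x : stab x = stab z ->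
    im t \subset im (redirect t x z) :|: orb (t x).
  move=> sx; apply/subsetP=> y; rewrite !inE => /codomP[v ->].
  have [/orbP[g ->] | vx] := boolP (v \in orb x).
    by rewrite ca_shift mem_orb_shift orb_refl orbT.
  by rewrite -(redirect_out t (w := z) _ vx) ?sx // codom_f.
have card_im : #|im t :|: orb z| = #|im t| + #|orb z|.
  rewrite cardsU (_ : _ :&: _ = set0) ?cards0 ?subn0 //.
  apply/setP=> y; rewrite !inE; apply: contraNF zt => /andP[/codomP[v ->]].
  by case/orbP=> g /esym/shiftV; rewrite -ca_shift => ->; rewrite codom_f.
have [/existsP[x /andP[/eqP sx nstx]] | /existsPn stB] :=
  boolP [exists x, (stab x == stab z) && (stab (t x) != stab z)].
  exists x, z; split=> //; first exact: factor.
  have lt_orb : #|orb (t x)| < #|orb z|.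
    have := card_orbit_stab (shift_action gT A) [set: gT] z.
    rewrite -(card_orbit_stab (shift_action gT A) [set: gT] (t x)) !setTI.
    have lt_stab : #|stab z| < #|stab (t x)|.
      by apply: proper_card; rewrite properEneq eq_sym nstx -sx stab_ca.
    (* By orbit-stabiliser both products equal the order of the group, so the larger stabiliser has
       the smaller orbit. *)
    move=> eq_mul; rewrite -(ltn_pmul2r (cardG_gt0 (stab (t x)))) -eq_mul.
    by rewrite ltn_pmul2l // (cardD1 z) orb_refl.
  rewrite -!(cardsE (mem (codom _))) -(ltn_add2r #|orb z|) -card_im.
  apply: (@leq_ltn_trans #|im (redirect t x z) :|: orb (t x)|).
    by rewrite subset_leq_card // subUset im_t // (subset_trans (orbz x sx)) ?subsetUl.
  by rewrite cardsU (leq_ltn_trans (leq_subr _ _)) // ltn_add2l.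
pose B := [set y | stab y == stab z].
have tB y : y \in B -> t y \in B.
  by rewrite !inE => sy; have := stB y; rewrite sy negbK.
(* [t] maps [B] into itself but misses [z], so by finiteness it is not injective there. *)
have /dinjectivePn[x Bx [y /andP[/= yx By] txy]] : ~~ dinjectiveb t B.
  apply: contra zt => /dinjectiveP inj_t.
  have tBE : t @: B = B.
    apply/eqP; rewrite eqEcard card_in_imset ?leqnn ?andbT //.
    by apply/subsetP=> _ /imsetP[y By ->]; apply: tB.
  have : z \in t @: B by rewrite tBE inE.
  by case/imsetP=> y _ ->; rewrite codom_f.
have sx : stab x = stab z by rewrite inE in Bx; apply/eqP.
(* If [y = shift x g], then [g] fixes [t x], hence fixes [x], contradicting that [x] and [y] are
   distinct. *)
have yNx : y \notin orb x.
  apply: contra yx => /orbP[g yE]; apply/eqP; rewrite yE; apply/stabP.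
  have /eqP -> : stab x == stab (t x) by rewrite sx eq_sym; have := tB x Bx; rewrite inE.
  by apply/stabP; rewrite -ca_shift -yE.
exists x, z; split=> //; first exact: factor.
rewrite -!(cardsE (mem (codom _))).
have im_tx : orb (t x) \subset im (redirect t x z).
  apply/subsetP=> _ /orbP[g ->]; rewrite txy -ca_shift inE.
  by rewrite -(redirect_out t (w := z) (x := x)) ?sx ?mem_orb_shift // codom_f.
apply: (@leq_trans #|im t :|: orb z|).
  by rewrite card_im -addn1 leq_add2l (cardD1 z) orb_refl.
rewrite subset_leq_card // subUset orbz // andbT.
by apply: subset_trans (im_t x sx) _; rewrite subUset subxx.
Qed.

Lemma collapses_generate (W : {set ca}) :
    (forall s t, s \in W -> t \in W -> ca_comp s t \in W) ->
    ICA gT A \subset W ->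
    (forall x y, stab x \subset stab y -> y \notin orb x -> collapse x y \in W) ->
  W = [set: ca].
Proof.
move=> mulW /subsetP sIW Wxy; apply/setP=> t; rewrite [RHS]inE.
(* Induction on the number of configurations missing from the image. *)
have [n] := ubnP (#|{: conf}| - #|codom t|); elim: n t => // n IHn t le_n.
have [inj_t | /injectiveP ninj] := boolP (injectiveb t).
  by rewrite sIW // mem_ICA.
have [x [z [sx zx tE lt_im]]] := factor_collapse ninj.
rewrite tE; apply: mulW; last first.
  by apply: Wxy; rewrite -?sx ?stab_ca // orb_sym.
apply: IHn; rewrite -ltnS; apply: leq_trans le_n; rewrite ltnS ltn_sub2l //.
exact: leq_trans lt_im (max_card _).
Qed.

(** * Orbit counts and the types that occur *)

Lemma conj_class_abelian (K : {set gT}) : conj_class K = [set K].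
Proof.
apply/setP=> L; rewrite inE; apply/imsetP/eqP=> [[g _ ->] | ->].
  by apply/normP; apply: (subsetP (sub_abelian_norm cGG _)); rewrite ?inE ?subsetT.
by exists 1; rewrite ?inE // conjsg1.
Qed.

(** The configuration [x0] rules out a count of zero, so a count different from one means at least
    two orbits. *)
Lemma orbit_count_neq1 (H : {group gT}) x0 :
    stab x0 = H ->
  reflect (exists x y, [/\ stab x = H, stab y = H & y \notin orb x])
          (orbit_count A H != 1%N).
Proof.
have boxP x : reflect (stab x = H) (x \in stab_box A H).
  by rewrite inE conj_class_abelian inE; apply: eqP.
have orb_box x : (orb x \subset stab_box A H) = (x \in stab_box A H).
  apply/subsetP/idP=> [|/boxP sx y /stab_orb sy]; first by apply; apply: orb_refl.
  by apply/boxP; rewrite sy.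
move=> sx0; rewrite /orbit_count; set O := [set _ in _ | _].
have OP x : (orb x \in O) = (x \in stab_box A H).
  by rewrite inE orb_box imset_f ?inE.
apply: (iffP idP) => [neq1 | [x [y [sx sy yx]]]].
  have Ox0 : orb x0 \in O by rewrite OP; apply/boxP.
  have /subsetPn[C OC neqC] : ~~ (O \subset [set orb x0]).
    apply: contra neq1 => /subset_leq_card; rewrite cards1 => leO.
    by rewrite eqn_leq leO card_gt0; apply/set0Pn; exists (orb x0).
  have /setIdP[/imsetP[y _ CE] _] := OC; rewrite {C}CE OP in OC neqC.
  exists x0, y; split=> //; first exact/boxP.
  by apply: contra neqC => yx0; rewrite inE; apply/eqP; apply/orbit_eqP.
apply/negP=> /cards1P[C OE].
have: orb x \in O by rewrite OP; apply/boxP.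
have: orb y \in O by rewrite OP; apply/boxP.
rewrite OE !inE => /eqP yC /eqP xC.
by rewrite xC -yC orb_refl in yx.
Qed.

(** Distinct constant configurations are distinct fixed points; hence the whole group contributes no
    correction term. *)
Lemma orbit_count_setT : 1 < #|A| -> orbit_count A [set: gT] != 1%N.
Proof.
case/card_gt1P=> a [b [_ _ ab]]; pose c d : conf := [ffun=> d].
have cE d g : shift (c d) g = c d by apply/ffunP=> h; rewrite !ffunE.
have sc d : stab (c d) = [set: gT]%G.
  by apply/setP=> g; rewrite [RHS]inE; apply/stabP.
apply/(orbit_count_neq1 (sc a)); exists (c a), (c b); split=> //.
by apply/orbP=> -[g]; rewrite cE => /ffunP/(_ 1) /eqP; rewrite !ffunE eq_sym (negPf ab).
Qed.

(** The indicator of [H] works: its shift by [g] is the indicator of the coset [H g]. *)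
Lemma stab_surj (H : {group gT}) : 1 < #|A| -> exists x, stab x = H.
Proof.
case/card_gt1P=> a [b [_ _ ab]]; pose x : conf := [ffun g => if g \in H then a else b].
exists x; apply/setP=> g; apply/stabP/idP=> [/ffunP/(_ g) | Hg].
  rewrite !ffunE mulgV group1; case: ifP => // _ /eqP.
  by rewrite (negPf ab).
by apply/ffunP=> h; rewrite !ffunE groupMr ?groupV.
Qed.

Definition proper_edges : {set {group gT} * {group gT}} :=
  [set p : {group gT} * {group gT} | (p.1 \subset p.2)
    && ~~ ((p.1 == p.2) && (orbit_count A p.1 == 1%N))].

(** Stabilisers are constant on orbits, so distinct subgroups give distinct orbits for free; only a
    loop needs a second orbit with the same stabiliser. *)
Lemma proper_edgesP p : 1 < #|A| ->
  reflect (exists x y, [/\ stab x = p.1, stab y = p.2, stab x \subset stab y &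
                           y \notin orb x])
          (p \in proper_edges).
Proof.
case: p => H K cardA; rewrite inE /=.
apply: (iffP andP) => [[sHK] | [x [y [sx sy + yx]]]].
  have [x sx] := stab_surj H cardA; have [<- /= | neqHK _] := eqVneq H K.
    case/(orbit_count_neq1 sx) => [{sx}x [y [sx sy yx]]].
    by exists x, y; rewrite sx sy.
  have [y sy] := stab_surj K cardA; exists x, y; rewrite sx sy; split=> //.
  by apply: contra neqHK => /stab_orb sxy; rewrite -val_eqE /= -sx -sy sxy.
rewrite sx sy => sHK; split=> //; rewrite negb_and; case: eqVneq => //= HK.
by apply/(orbit_count_neq1 sx); exists x, y; rewrite HK in sx *.
Qed.

(** * The two bounds on the rank, and the count of edges *)

Lemma relative_rank_ICA :
  1 < #|A| -> relative_rank (@ca_comp gT A) (ICA gT A) = #|proper_edges|.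
Proof.
move=> cardA; apply: relative_rank_eq => [V genV|].
  (* Lower bound: [f] picks a member of [V] of each type; [idc] is a filler value off
     [proper_edges]. *)
  have /fin_all_exists[f fP] p :
      exists t, p \in proper_edges -> t \in V /\ collapse_type p t.
    have [/(proper_edgesP _ cardA)[x [y [sx sy sxy yx]]] | _] :=
      boolP (p \in proper_edges); last by exists idc.
    have [/existsP[t /andP[Vt pt]] | /existsPn noV] :=
      boolP [exists t, (t \in V) && collapse_type p t]; first by exists t.
    (* Were no member of [V] of type [p], everything generated would avoid this type, yet
       [collapse x y] has it. *)
    have subW : submonoid_gen (@ca_comp gT A) (ICA gT A :|: V)
        \subset [set t | ~~ collapse_type p t].
      apply: submonoid_gen_min.
        apply/andP; split.
          rewrite inE; apply/collapse_typeP=> -[[]] u v.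
          by rewrite !ca_idE.
        apply/forall_inP=> u; rewrite inE => pu; apply/forall_inP=> v.
        rewrite !inE => pv; apply/negP => /collapse_type_comp.
        by rewrite (negPf pu) (negPf pv).
      apply/subsetP=> t /setUP[It | Vt]; rewrite inE.
        by apply/collapse_typeP=> -[[]]; apply: ICA_inj.
      by have := noV t; rewrite Vt.
    have := subsetP subW (collapse x y); rewrite genV !inE => /(_ isT)/negP[].
    by apply: collapse_typed; rewrite -?sx -?sy.
  have injf : {in proper_edges &, injective f}.
    move=> p q /fP[_ pt] /fP[_ qt] eqf; apply: collapse_type_uniq pt _.
    by rewrite eqf.
  rewrite -(card_in_imset injf) subset_leq_card //.
  by apply/subsetP=> _ /imsetP[p /fP[Vt _] ->].
(* Upper bound: one collapse per edge; conjugation by units supplies the others. *)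
have /fin_all_exists[f fP] p : exists t, p \in proper_edges ->
    exists x y, [/\ stab x = p.1, stab y = p.2, y \notin orb x & t = collapse x y].
  have [/(proper_edgesP _ cardA)[x [y [sx sy _ yx]]] | _] :=
    boolP (p \in proper_edges); last by exists idc.
  by exists (collapse x y) => _; exists x, y.
exists (f @: proper_edges); last exact: leq_imset_card.
set U := _ :|: _; have /subsetP subU := sub_submonoid_gen (@ca_comp gT A) U.
have mulW := @submonoid_genM _ _ (@ca_comp gT A) U.
have subI : ICA gT A \subset submonoid_gen (@ca_comp gT A) U.
  by apply/subsetP=> t It; apply: subU; apply/setUP; left.
apply: collapses_generate => // x y sxy yx.
have Ep : ('C[x | shift_action gT A]%G, 'C[y | shift_action gT A]%G)
    \in proper_edges.
  by apply/proper_edgesP=> //; exists x, y.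
have [x' [y' [/= sx sy yx' fE]]] := fP _ Ep.
apply: (@gen_collapse _ x' y') => //; first by rewrite sx sy.
by apply: subU; apply/setUP; right; rewrite -fE imset_f.
Qed.

Lemma card_subgroup_edges :
  #|subgroup_edges gT| =
    #|[set p : {group gT} * {group gT} | p.1 \subset p.2]|.
Proof.
pose cc (p : {group gT} * {group gT}) := (conj_class p.1, conj_class p.2).
rewrite -(card_imset (f := cc)) => [|[H K] [H' K']]; last first.
  rewrite /cc !conj_class_abelian => -[/set1_inj HH' /set1_inj KK'].
  by congr (_, _); apply: val_inj.
apply: eq_card => -[c d]; rewrite inE /=; apply/and3P/imsetP.
  case=> _ _ /existsP[H /existsP[K /and3P[/eqP-> /eqP-> /existsP[g sHK]]]].
  exists (H, K) => //; rewrite inE /=.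
  have : K :^ g \in conj_class K by apply: imset_f; rewrite inE.
  by rewrite conj_class_abelian => /set1P <-.
case=> -[H K]; rewrite inE /= => sHK [-> ->]; split; try exact: imset_f.
apply/existsP; exists H; apply/existsP; exists K; rewrite !eqxx /=.
by apply/existsP; exists 1; rewrite conjsg1.
Qed.

Lemma card_proper_edges :
  #|proper_edges| =
    (#|subgroup_edges gT| - #|[set K : {group gT} | orbit_count A K == 1%N]|)%N.
Proof.
rewrite card_subgroup_edges; set D := [set _ | _]; set L := [set _ | _].
have inj_d : injective (fun K : {group gT} => (K, K)) by move=> ? ? [].
rewrite -(card_imset L inj_d).
have -> : proper_edges = D :\: [set (K, K) | K in L].
  apply/setP=> -[H K]; rewrite !inE /= andbC; congr (~~ _ && _).
  apply/andP/imsetP=> [[/eqP <- oc] | [K0 + [-> ->]]]; last by rewrite inE eqxx.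
  by exists H; rewrite ?inE.
(* All removed loops lie in [D], so each of them counts in the subtraction. *)
rewrite cardsD (setIidPr _) //.
by apply/subsetP=> _ /imsetP[K _ ->]; rewrite inE /=.
Qed.

End CellularAutomata.

Theorem theorem4 (gT : finGroupType) (A : finType)
    (hG : abelian [set: gT]) (hA : (2 <= #|A|)%N)
    (r : nat) (H : 'I_r.+1 -> {group gT})
    (hH : bijective H) (hH1 : H ord0 = [set: gT]%G) :
  relative_rank (@ca_comp gT A) (ICA gT A) =
    (#|subgroup_edges gT|
       - \sum_(i < r.+1 | i != ord0) (orbit_count A (H i) == 1))%N.
Proof.
rewrite relative_rank_ICA // card_proper_edges //; congr (_ - _)%N.
rewrite -sum1_card [LHS](reindex H) /=; last exact: onW_bij.
rewrite big_mkcond [RHS]big_mkcond; apply: eq_bigr => i _; rewrite inE.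
(* At [ord0] the subgroup is the whole group, whose orbit count is never one, so omitting this index
   changes nothing. *)
have [-> | _] := eqVneq i ord0; last by case: eqP.
by rewrite hH1 /= (negPf (orbit_count_setT hG hA)).
Qed.
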